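(* Let $B=LDU$ be an adjacent bidiagonal factorization of an $n\times n$ nonsingular totally nonnegative matrix $B$. Delete the zero-parameter factors. Record the position sequence of the factors $x_i(t)$ of $U$, in their factor order (left to right), as $Q_+$, and record the position sequence of the factors $x_i(t)$ of $L^T$, in its factor order (left to right), as $Q_-$. Then, for every $m\ge1$ and every $1\le k<n$, $$\Delta_{L_k,R_k}(B^m)>0\iff c_{Q_+^m}^+(L_k)=R_k,$$ $$\Delta_{R_k,L_k}(B^m)>0\iff c_{Q_-^m}^+(L_k)=R_k.$$ If $B=A$ is oscillatory, then both sequences $Q_+$ and $Q_-$ are complete and, for $1\le k<n$, $$\tau_k^{\mathrm{UR}}(A)=t_k(Q_+),\qquad \tau_k^{\mathrm{LL}}(A)=t_k(Q_-),\qquad e_k(A)=\max\{t_k(Q_+),t_k(Q_-)\}.$$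
   Context: All matrices are real and have order $n\ge2$. A matrix is totally nonnegative (TN) if all its minors are $\ge0$ and totally positive (TP) if all its minors are $>0$; a square TN matrix is oscillatory if some positive power of it is TP. $\Delta_{I,J}(B)=\det B[I,J]$ is the minor with row set $I$ and column set $J$. $L_k=\{1,\dots,k\}$, $R_k=\{n-k+1,\dots,n\}$. Let $E_{ij}$ be the matrix unit with a single $1$ in position $(i,j)$. For $t\ge0$ and $1\le i<n$ set $x_i(t)=I+tE_{i,i+1}$ and $y_i(t)=I+tE_{i+1,i}$; $i$ is the position of the factor. An adjacent bidiagonal factorization of $B$ is a factorization $B=LDU$ in which $D$ is a positive diagonal matrix and $L$, $U$ are ordered products of factors $y_i(t)$ and $x_i(t)$, respectively ($t\ge0$). Since $y_i(t)^T=x_i(t)$, $L^T$ is an ordered product of factors $x_i(t)$. For $a\in\{1,\dots,n-1\}$ and $I\subseteq\{1,\dots,n\}$, let $c_a^+(I)=(I\setminus\{a\})\cup\{a+1\}$ if $a\in I$ and $a+1\notin I$, and $c_a^+(I)=I$ otherwise. For a finite sequence $Q=(q_1,\dots,q_\ell)$ in $\{1,\dots,n-1\}$, $c_Q^+$ denotes the successive application of $c_{q_1}^+,\dots,c_{q_\ell}^+$ in that order ($c_{q_1}^+$ first), and $Q^m$ is the $m$-fold concatenation of $Q$ with itself. $Q$ is complete if every element of $\{1,\dots,n-1\}$ occurs in it. $t_k(Q)$ is the least $m\ge1$ with $c_{Q^m}^+(L_k)=R_k$ ($\infty$ if there is none). For an oscillatory matrix $A$: $\tau_k^{\mathrm{UR}}(A)=\min\{m\ge1:\Delta_{L_k,R_k}(A^m)>0\}$,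 $\tau_k^{\mathrm{LL}}(A)=\min\{m\ge1:\Delta_{R_k,L_k}(A^m)>0\}$, and $e_k(A)=\min\{m\ge1:\text{all minors of order }k\text{ of }A^m\text{ are positive}\}$. *)

(* Defs.v *)
From HB Require Import structures.
From mathcomp Require Import all_boot all_order all_algebra.
From mathcomp Require Import boolp reals.

Set Implicit Arguments.
Unset Strict Implicit.
Unset Printing Implicit Defensive.

Import Order.TTheory GRing.Theory Num.Theory.
Local Open Scope ring_scope.

(* Rows and columns are indexed by 'I_n and positions by 'I_n.-1, both from 0:
   the mathematical index i (in 1..n) is the ordinal i-1. *)

Section Minors.
Variables (R : realType) (n : nat).
Implicit Types (I J : {set 'I_n}) (B : 'M[R]_n).

(* Only meaningful when #|I| = #|J|; the default of nth is then irrelevant.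
   The enumeration of a set of ordinals is increasing. *)
Definition minor I J B : R :=
  \det (\matrix_(i < #|I|, j < #|I|)
          B (enum_val i) (nth (enum_val i) (enum J) j)).

Definition totally_nonnegative B : Prop :=
  forall I J, #|I| = #|J| -> 0 <= minor I J B.

Definition totally_positive B : Prop :=
  forall I J, #|I| = #|J| -> 0 < minor I J B.

Definition oscillatory B : Prop :=
  totally_nonnegative B /\ exists2 m, (0 < m)%N & totally_positive (B ^+ m).

End Minors.

Section Positions.
Variable n : nat.
Implicit Types (a : 'I_n.-1) (I : {set 'I_n}) (Q : seq 'I_n.-1).

Lemma pos_lo_subproof a : (a < n)%N.
Proof. exact: leq_trans (ltn_ord a) (leq_pred n). Qed.

Lemma pos_hi_subproof a : (a.+1 < n)%N.
Proof. by rewrite -ltn_predRL. Qed.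

Definition pos_lo a : 'I_n := Ordinal (pos_lo_subproof a).
Definition pos_hi a : 'I_n := Ordinal (pos_hi_subproof a).

Definition init_set (k : nat) : {set 'I_n} := [set i : 'I_n | (i < k)%N].
Definition final_set (k : nat) : {set 'I_n} := [set i : 'I_n | (n - k <= i)%N].

Definition cplus a I : {set 'I_n} :=
  if (pos_lo a \in I) && (pos_hi a \notin I)
  then pos_hi a |: (I :\ pos_lo a) else I.

Definition cplus_seq Q I : {set 'I_n} := foldl (fun J a => cplus a J) I Q.

Definition seq_power (m : nat) Q : seq 'I_n.-1 := flatten (nseq m Q).

Definition complete Q : Prop := forall a, a \in Q.

End Positions.

Section Factorization.
Variables (R : realType) (n : nat).

Definition x_factor (a : 'I_n.-1) (t : R) : 'M[R]_n :=
  1%:M + t *: delta_mx (pos_lo a) (pos_hi a).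

Definition y_factor (a : 'I_n.-1) (t : R) : 'M[R]_n :=
  1%:M + t *: delta_mx (pos_hi a) (pos_lo a).

(* A factor is recorded as its position and its parameter. *)
Implicit Types (s : seq ('I_n.-1 * R)) (d : 'rV[R]_n).

Definition x_prod s : 'M[R]_n := \prod_(f <- s) x_factor f.1 f.2.
Definition y_prod s : 'M[R]_n := \prod_(f <- s) y_factor f.1 f.2.

Definition adjacent_bidiagonal_factorization (B : 'M[R]_n) sL d sU : Prop :=
  [/\ {in sL, forall f, 0 <= f.2}, forall i, 0 < d 0 i,
      {in sU, forall f, 0 <= f.2} &
      B = y_prod sL *m diag_mx d *m x_prod sU].

Definition positions s : seq 'I_n.-1 := [seq f.1 | f <- s & f.2 != 0].

Lemma trmx_y_prod s : (y_prod s)^T = x_prod (rev s).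
Proof.
rewrite /y_prod /x_prod; elim: s => [|f s IHs]; first by rewrite !big_nil trmx1.
rewrite big_cons rev_cons -cats1 big_cat big_seq1 /= -IHs.
rewrite -[LHS]/((_ *m _)^T) trmx_mul; congr (_ *m _).
by rewrite /y_factor linearD /= linearZ /= trmx1 trmx_delta.
Qed.

Definition Qplus sU : seq 'I_n.-1 := positions sU.

(* By trmx_y_prod, the x-factors of the transpose of y_prod sL are those
   recorded in rev sL. *)
Definition Qminus sL : seq 'I_n.-1 := positions (rev sL).

End Factorization.

(* The least m >= 1 satisfying P; None stands for infinity. *)
Definition least_time (P : nat -> Prop) : option nat :=
  match pselect (exists m, (0 < m)%N && `[< P m >]) with
  | left exP => Some (ex_minn exP)
  | right _ => None
  end.

Definition time_max (s t : option nat) : option nat :=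
  match s, t with
  | Some a, Some b => Some (maxn a b)
  | _, _ => None
  end.

Definition t_time n (k : nat) (Q : seq 'I_n.-1) : option nat :=
  least_time
    (fun m => cplus_seq (seq_power m Q) (init_set n k) = final_set n k).

Section Exponents.
Variables (R : realType) (n : nat).
Implicit Types (k : nat) (A : 'M[R]_n).

(* A totally positive power of A witnesses each of these three minima, so they
   are finite whenever A is oscillatory. *)
Definition tau_UR k A : option nat :=
  least_time (fun m => 0 < minor (init_set n k) (final_set n k) (A ^+ m)).

Definition tau_LL k A : option nat :=
  least_time (fun m => 0 < minor (final_set n k) (init_set n k) (A ^+ m)).

Definition exponent k A : option nat :=
  least_time (fun m => forall I J : {set 'I_n},
    #|I| = k -> #|J| = k -> 0 < minor I J (A ^+ m)).

End Exponents.

(* Main.v *)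
Require Import Defs.
From mathcomp Require Import all_boot all_order all_algebra.
From mathcomp Require Import boolp reals zify.

Set Implicit Arguments.
Unset Strict Implicit.
Unset Printing Implicit Defensive.

Import Order.TTheory GRing.Theory Num.Theory.
Local Open Scope ring_scope.

(** Left multiplication by an elementary bidiagonal factor with parameter
    t > 0 turns a minor with row set I into the same minor plus, when a given
    element of I has a free neighbour, t times the minor in which this element
    has moved there (minor_shear).
    Along a factorization there is therefore no cancellation: every minor of
    B ^+ m is nonnegative, and the one at (I, J) is positive exactly when I can
    be carried to J by letting each factor, from left to right, either act on
    the current set or leave it alone; an x-factor moves an element up, a
    y-factor moves one down (realizes_exp).  The theorem thus becomes a question
    about these moves of k-element sets, which are compared by their level
    functions, level I j being the number of elements of I that are >= j.

    For the upper right corner: upward moves are monotone and increasing,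
    downward moves are decreasing, so applying every upward move and no
    downward move dominates any other choice.  As the final set is the largest
    of its size, it is reached if and only if this greedy choice reaches it
    (reach_init_final).  The lower left corner is the upper right corner of the
    transpose.

    For all minors of order k: given one way to carry the initial set to the
    final one and one way back, consider at each time the level function which
    goes from that of I towards that of J, pushed up by the first path where it
    must increase and pushed down by the second path where it must decrease
    (clamp).  It is again the level function of a set, this set follows the same
    word of moves, and it leads from I to J (reach_all).  So positivity of the
    two corner minors forces positivity of all minors of order k, and the
    exponent is the larger of the two corner times, both conditions being
    inherited by larger powers.  Completeness holds because every position
    must be crossed on the way from an initial to a final set. *)

(** * Level functions of sets of ordinals *)

Definition level n (I : {set 'I_n}) (j : nat) : nat :=
  (\sum_(i in I) (j <= i))%N.

Lemma level0 n (I : {set 'I_n}) : level I 0 = #|I|.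
Proof. by rewrite -sum1_card; apply: eq_bigr. Qed.

Lemma level_end n (I : {set 'I_n}) j : (n <= j)%N -> level I j = 0%N.
Proof. by move=> le_nj; apply: big1 => i _; have := ltn_ord i; lia. Qed.

Lemma levelS n (I : {set 'I_n}) (j : 'I_n) :
  level I j = (level I j.+1 + (j \in I))%N.
Proof.
have -> : ((j \in I) = \sum_(i in I) (i == j) :> nat)%N.
  have [jI|jI] := boolP (j \in I).
    by rewrite (bigD1 j) //= eqxx big1 // => i /andP[_ /negPf ->].
  by rewrite big1 // => i iI; case: eqP iI jI => // -> ->.
rewrite -big_split; apply: eq_bigr => i _ /=.
by rewrite -(inj_eq val_inj) /=; lia.
Qed.

Lemma level_slope n (I : {set 'I_n}) j :
  (level I j.+1 <= level I j <= (level I j.+1).+1)%N.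
Proof.
have [lt_jn|le_nj] := ltnP j n; last by rewrite !level_end //; lia.
by have := levelS I (Ordinal lt_jn) => /= ->; case: (_ \in I); lia.
Qed.

(** These bounds are attained by the initial and the final sets (level_init,
    level_final), which are thus the extreme sets of a given size. *)
Lemma level_bound n (I : {set 'I_n}) j :
  (#|I| - j <= level I j <= minn #|I| (n - j))%N.
Proof.
apply/andP; split.
  elim: j => [|j IHj]; first by rewrite level0 subn0.
  by have := level_slope I j; lia.
rewrite leq_min; apply/andP; split.
  elim: j => [|j IHj]; first by rewrite level0.
  by have := level_slope I j; lia.
have [le_nj|lt_jn] := leqP n j; first by rewrite level_end.
rewrite -{1}(subKn (ltnW lt_jn)); elim: (n - j)%N => [|i IHi].
  by rewrite level_end ?subn0.
have [le_ni|lt_in] := leqP n i.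
  have -> : (n - i.+1 = n - i)%N by lia.
  by lia.
have := level_slope I (n - i.+1).
have -> : (n - i.+1).+1 = (n - i)%N by lia.
by lia.
Qed.

Lemma mem_level n (I : {set 'I_n}) (j : 'I_n) :
  (j \in I) = (level I j.+1 < level I j)%N.
Proof. by rewrite (levelS I j); case: (j \in I); lia. Qed.

Lemma level_inj n (I J : {set 'I_n}) : level I =1 level J -> I = J.
Proof. by move=> eqIJ; apply/setP => j; rewrite !mem_level !eqIJ. Qed.

Definition set_of_level n (h : nat -> nat) : {set 'I_n} :=
  [set i : 'I_n | (h i.+1 < h i)%N].

(** Level functions of sets are exactly the functions that end at 0 and go down
    by 0 or 1 at each step; this is what makes lattice operations on levels
    available as operations on sets. *)
Lemma set_of_levelK n (h : nat -> nat) :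
  (forall j, h j.+1 <= h j <= (h j.+1).+1)%N -> h n = 0%N ->
  {in iota 0 n.+1, level (set_of_level n h) =1 h}.
Proof.
move=> slope h_n j; rewrite mem_iota /= add0n ltnS => le_jn.
rewrite -(subKn le_jn); elim: (n - j)%N => [|i IHi].
  by rewrite subn0 level_end.
have [le_ni|lt_in] := leqP n i.
  by move: IHi; have -> : (n - i.+1 = n - i)%N by lia.
have lt_n : (n - i.+1 < n)%N by lia.
have := levelS (set_of_level n h) (Ordinal lt_n); rewrite inE /= => ->.
have := slope (n - i.+1)%N.
have -> : (n - i.+1).+1 = (n - i)%N by lia.
by rewrite IHi; lia.
Qed.

(** * Moves *)

Definition transfer n (p q : 'I_n) (I : {set 'I_n}) : {set 'I_n} :=
  if (p \in I) && (q \notin I) then q |: (I :\ p) else I.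

Lemma level_transfer n (p q : 'I_n) (I : {set 'I_n}) j :
  p \in I -> q \notin I ->
  (level (transfer p q I) j + (j <= p) = level I j + (j <= q))%N.
Proof.
move=> pI qI; rewrite /transfer pI qI /= /level.
rewrite big_setU1 ?inE ?(negPf qI) ?andbF //= [in RHS](big_setD1 p pI) /=.
by rewrite addnC addnA [RHS]addnC addnCA addnA.
Qed.

Lemma card_transfer n (p q : 'I_n) (I : {set 'I_n}) : #|transfer p q I| = #|I|.
Proof.
rewrite /transfer; case: ifP => // /andP[pI qI].
by rewrite cardsU1 !inE (negPf qI) andbF (cardsD1 p I) pI.
Qed.

(** The boolean is the direction: upward moves are those of x-factors, downward
    moves those of y-factors. *)
Definition move n (mv : bool * 'I_n.-1) (I : {set 'I_n}) : {set 'I_n} :=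
  if mv.1 then cplus mv.2 I else transfer (pos_hi mv.2) (pos_lo mv.2) I.

Lemma mem_lo n (I : {set 'I_n}) (a : 'I_n.-1) :
  (pos_lo a \in I) = (level I a.+1 < level I a)%N.
Proof. exact: mem_level. Qed.

Lemma mem_hi n (I : {set 'I_n}) (a : 'I_n.-1) :
  (pos_hi a \in I) = (level I a.+2 < level I a.+1)%N.
Proof. exact: mem_level. Qed.

Lemma level_cplus n (a : 'I_n.-1) (I : {set 'I_n}) j :
  level (cplus a I) j =
  (level I j + [&& j == a.+1, level I a.+1 < level I a
                 & level I a.+1 <= level I a.+2])%N.
Proof.
rewrite (leqNgt _ (level I a.+2)) -mem_lo -mem_hi; have [jI|] :=
  boolP ((pos_lo a \in I) && (pos_hi a \notin I)).
  have /andP[loI hiI] := jI; have := level_transfer j loI hiI.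
  by rewrite /transfer /cplus jI /=; lia.
by move=> nI; rewrite /cplus (negPf nI) andbF addn0.
Qed.

Lemma level_cminus n (a : 'I_n.-1) (I : {set 'I_n}) j :
  level (move (false, a) I) j =
  (level I j - [&& j == a.+1, level I a <= level I a.+1
                 & level I a.+2 < level I a.+1])%N.
Proof.
rewrite /move (leqNgt _ (level I a.+1)) -mem_lo -mem_hi; have [jI|] :=
  boolP ((pos_hi a \in I) && (pos_lo a \notin I)).
  have /andP[hiI loI] := jI; have := level_transfer j hiI loI.
  rewrite /transfer hiI loI /=; lia.
by move=> nI; rewrite /transfer (negPf nI)
  [X in _ && X]andbC (negPf nI) andbF subn0.
Qed.

(** Each move of w may be performed or skipped. *)
Fixpoint reach n (w : seq (bool * 'I_n.-1)) (I J : {set 'I_n}) : bool :=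
  if w is mv :: w' then reach w' I J || reach w' (move mv I) J else I == J.

Definition ups n (w : seq (bool * 'I_n.-1)) : seq 'I_n.-1 :=
  [seq mv.2 | mv <- w & mv.1].

(** Only the level at a+1 changes.  If I and J agree there and I moves, then I
    has a step at a and none at a+1, and comparing the levels at a and a+2
    shows the same for J. *)
Lemma cplus_mono n (a : 'I_n.-1) (I J : {set 'I_n}) :
  (forall j, level I j <= level J j)%N ->
  (forall j, level (cplus a I) j <= level (cplus a J) j)%N.
Proof.
move=> leIJ j; rewrite !level_cplus.
have := (leIJ j, leIJ a, leIJ a.+1, leIJ a.+2).
case=> [[[]]]; have := level_slope J a; have := level_slope J a.+1.
by case: eqP => [->|]; lia.
Qed.

(** Greedy choice is optimal: performing all upward moves and no downward one
    keeps the set above whatever another choice produces. *)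
Lemma reach_dominated n (w : seq (bool * 'I_n.-1)) (I J G : {set 'I_n}) :
  (forall j, level I j <= level G j)%N -> reach w I J ->
  (forall j, level J j <= level (cplus_seq (ups w) G) j)%N.
Proof.
elim: w I G => [|[b a] w IHw] I G leIG /=; first by move/eqP <-.
case: b => /= /orP[] rIJ; apply: (IHw _ _ _ rIJ) => // j.
- by rewrite level_cplus (leq_trans (leIG j)) ?leq_addr.
- exact: cplus_mono.
- by rewrite level_cminus (leq_trans (leq_subr _ _)).
Qed.

Lemma reach_cplus_seq n (w : seq (bool * 'I_n.-1)) (I : {set 'I_n}) :
  reach w I (cplus_seq (ups w) I).
Proof. by elim: w I => [|[[] a] w IHw] I //=; rewrite IHw ?orbT. Qed.

(** * Initial and final sets *)

Lemma card_init n k : (k <= n)%N -> #|init_set n k| = k.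
Proof.
move=> le_kn; rewrite -sum1_card (eq_bigl (fun i : 'I_n => (i < k)%N)) => [|i].
  by rewrite -(big_ord_widen _ (fun=> 1%N)) // sum_nat_const card_ord muln1.
by rewrite inE.
Qed.

Lemma card_final n k : (k <= n)%N -> #|final_set n k| = k.
Proof.
move=> le_kn; rewrite -[final_set n k]setCK cardsCs setCK card_ord.
have -> : ~: final_set n k = init_set n (n - k).
  by apply/setP => i; rewrite !inE ltnNge.
by rewrite card_init ?leq_subr ?subKn.
Qed.

Lemma level_init n k j : (k <= n)%N -> level (init_set n k) j = (k - j)%N.
Proof.
move=> le_kn; have [le_nj|lt_jn] := leqP n j; first by rewrite level_end //; lia.
elim: j lt_jn => [|j IHj] lt_jn; first by rewrite level0 card_init ?subn0.
have lt_jn' := ltnW lt_jn; have := levelS (init_set n k) (Ordinal lt_jn').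
by rewrite inE /= IHj //; lia.
Qed.

Lemma level_final n k j :
  (k <= n)%N -> level (final_set n k) j = minn k (n - j).
Proof.
move=> le_kn; have [le_nj|lt_jn] := leqP n j; first by rewrite level_end //; lia.
elim: j lt_jn => [|j IHj] lt_jn; first by rewrite level0 card_final //; lia.
have lt_jn' := ltnW lt_jn; have := levelS (final_set n k) (Ordinal lt_jn').
by rewrite inE /= IHj //; lia.
Qed.

Lemma card_cplus_seq n (Q : seq 'I_n.-1) (I : {set 'I_n}) :
  #|cplus_seq Q I| = #|I|.
Proof.
by elim: Q I => //= a Q IHQ I; rewrite IHQ (card_transfer (pos_lo a) (pos_hi a)).
Qed.

Lemma reach_init_final n k (w : seq (bool * 'I_n.-1)) : (k <= n)%N ->
  reach w (init_set n k) (final_set n k)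
  <-> cplus_seq (ups w) (init_set n k) = final_set n k.
Proof.
move=> le_kn; split=> [r|<-]; last exact: reach_cplus_seq.
have dom := reach_dominated (fun j => leqnn _) r.
apply: level_inj => j; apply/eqP; rewrite eqn_leq dom andbT level_final //.
have := level_bound (cplus_seq (ups w) (init_set n k)) j.
by rewrite card_cplus_seq card_init // => /andP[].
Qed.

(** * Interpolating between two paths *)

(** The level i is to be turned into j: u is an increasing driver when j is the
    larger one, v a decreasing driver when it is the smaller one. *)
Definition clamp (i j u v : nat) : nat :=
  if (i <= j)%N then maxn i (minn j u) else minn i (maxn j v).

(** At a place where the comparison of i with j flips between two neighbours,
    the unit slopes leave room only for i = j on one side and a difference of 1
    on the other, so the two cases of clamp fit together. *)
Lemma clamp_slope (i i' j j' u u' v v' : nat) :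
  (i' <= i <= i'.+1)%N -> (j' <= j <= j'.+1)%N ->
  (u' <= u <= u'.+1)%N -> (v' <= v <= v'.+1)%N ->
  (clamp i' j' u' v' <= clamp i j u v <= (clamp i' j' u' v').+1)%N.
Proof. by rewrite /clamp; case: (leqP i j); case: (leqP i' j'); lia. Qed.

Lemma clamp_step (i j u u' v v' : nat) :
  (u <= u' <= u.+1)%N -> (v <= v' <= v.+1)%N ->
  (clamp i j u v <= clamp i j u' v' <= (clamp i j u v).+1)%N.
Proof. by rewrite /clamp; case: (leqP i j); lia. Qed.

Lemma clamp_start (i j u v : nat) : (u <= i <= v)%N -> clamp i j u v = i.
Proof. by rewrite /clamp; case: (leqP i j); lia. Qed.

Lemma clamp_end (i j u v : nat) : (v <= j <= u)%N -> clamp i j u v = j.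
Proof. by rewrite /clamp; case: (leqP i j); lia. Qed.

Definition between n (I J G H : {set 'I_n}) : {set 'I_n} :=
  set_of_level n
    (fun j => clamp (level I j) (level J j) (level G j) (level H j)).

Lemma level_between n (I J G H : {set 'I_n}) j :
  level (between I J G H) j =
  clamp (level I j) (level J j) (level G j) (level H j).
Proof.
have [lt_nj|le_jn] := ltnP n j.
  by rewrite !level_end // ltnW.
rewrite set_of_levelK ?mem_iota //; last by rewrite !level_end.
by move=> i; apply: clamp_slope; apply: level_slope.
Qed.

(** A change of the level at the single index a+1, by one unit in the right
    direction, can only come from the corresponding move: the unit slopes
    before and after force the moving element to be at its place and its
    target to be free. *)
Lemma move_of_level n (mv : bool * 'I_n.-1) (P P' : {set 'I_n}) :
  (forall j, j != mv.2.+1 -> level P' j = level P j) ->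
  (if mv.1 then level P mv.2.+1 <= level P' mv.2.+1 <= (level P mv.2.+1).+1
   else level P' mv.2.+1 <= level P mv.2.+1 <= (level P' mv.2.+1).+1)%N ->
  P' = P \/ P' = move mv P.
Proof.
case: mv => b a /= eqP' leP'.
have [eq_a|ne_a] := eqVneq (level P' a.+1) (level P a.+1).
  by left; apply: level_inj => j; case: (eqVneq j a.+1) => [->|/eqP'].
right; apply: level_inj => j.
have := (level_slope P' a, level_slope P' a.+1).
rewrite !(eqP' a) ?(eqP' a.+2); [|lia|lia].
case: b leP' => leP' slope; rewrite /= ?level_cplus ?level_cminus;
  by case: eqVneq => [->|/eqP' ->]; move: slope => [] /=; lia.
Qed.

(** The drivers perform or skip the same move independently of each other; a
    clamped level reacts to either of them in the same direction, by at most
    one unit in all. *)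
Lemma between_move n (mv : bool * 'I_n.-1) (I J G H G' H' : {set 'I_n}) :
  G' = G \/ G' = move mv G -> H' = H \/ H' = move mv H ->
  between I J G' H' = between I J G H \/
  between I J G' H' = move mv (between I J G H).
Proof.
case: mv => b a mG mH.
have step (K K' : {set 'I_n}) : K' = K \/ K' = move (b, a) K ->
    (forall j, j != a.+1 -> level K' j = level K j) /\
    (if b then level K a.+1 <= level K' a.+1 <= (level K a.+1).+1
     else level K' a.+1 <= level K a.+1 <= (level K' a.+1).+1)%N.
  case=> ->; first by split=> //; case: b {mG mH}; lia.
  case: b {mG mH}; split=> [j /negPf ne_j|];
    by rewrite ?level_cplus ?level_cminus ?ne_j /= ?addn0 ?subn0 //; lia.
have [[eqG leG] [eqH leH]] := (step _ _ mG, step _ _ mH).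
apply: move_of_level => [j ne_j|]; rewrite !level_between; first by rewrite eqG ?eqH.
by case: b leG leH {mG mH step} => /= leG leH; apply: clamp_step.
Qed.

Lemma reach_between n (w : seq (bool * 'I_n.-1)) (I J G H G' H' : {set 'I_n}) :
  reach w G G' -> reach w H H' ->
  reach w (between I J G H) (between I J G' H').
Proof.
elim: w G H => [|mv w IHw] G H /=; first by move=> /eqP-> /eqP->.
move=> rG rH.
have [G1 mG rG1] : exists2 G1, G1 = G \/ G1 = move mv G & reach w G1 G'.
  by case/orP: rG => r; [exists G; [left|] | exists (move mv G); [right|]].
have [H1 mH rH1] : exists2 H1, H1 = H \/ H1 = move mv H & reach w H1 H'.
  by case/orP: rH => r; [exists H; [left|] | exists (move mv H); [right|]].
have := IHw _ _ rG1 rH1.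
by case: (between_move I J mG mH) => -> ->; rewrite ?orbT.
Qed.

(** With the drivers going from initial to final and from final to initial, the
    interpolated set starts at I and stops at J, by the extremality of these
    two sets. *)
Lemma reach_all n k (w : seq (bool * 'I_n.-1)) (I J : {set 'I_n}) :
  (k <= n)%N -> #|I| = k -> #|J| = k ->
  reach w (init_set n k) (final_set n k) ->
  reach w (final_set n k) (init_set n k) -> reach w I J.
Proof.
move=> le_kn cI cJ rLR rRL; have := reach_between I J rLR rRL.
have bI := level_bound I; have bJ := level_bound J.
congr reach; apply: level_inj => j; rewrite level_between.
  by rewrite clamp_start // level_init // level_final // -cI.
by rewrite clamp_end // level_init // level_final // -cJ.
Qed.

(** * Minors under left multiplication by the factors *)

Lemma sorted_enum_ord n (I : {set 'I_n}) : sorted (relpre val ltn) (enum I).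
Proof.
rewrite /enum_mem sorted_filter //; first by move=> ? ? ?; apply: ltn_trans.
rewrite -sorted_map.
by rewrite -enumT val_enum_ord iota_ltn_sorted.
Qed.

(** This form frees the size of the determinant from the row set, so that minors
    with different row sets can be compared without casts. *)
Lemma minorE (R : realType) n k (x0 : 'I_n) (I J : {set 'I_n}) (M : 'M[R]_n) :
  #|I| = k -> #|J| = k ->
  minor I J M =
  \det (\matrix_(i < k, j < k) M (nth x0 (enum I) i) (nth x0 (enum J) j)).
Proof.
move=> <- cJ; rewrite /minor; congr (\det _); apply/matrixP => i j; rewrite !mxE.
rewrite (enum_val_nth x0); congr (M _ _).
by apply: set_nth_default; rewrite -cardE cJ.
Qed.

Definition adjacent n (p q : 'I_n) : bool := (p.+1 == q) || (q.+1 == p).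

(** Adjacency ensures that the replaced element keeps its rank, so that no sign
    appears when the rows are listed in increasing order. *)
Lemma enum_transfer n (p q : 'I_n) (I : {set 'I_n}) :
  adjacent p q -> p \in I -> q \notin I ->
  enum (transfer p q I) = [seq if i == p then q else i | i <- enum I].
Proof.
move=> pq pI qI; apply: (irr_sorted_eq (leT := relpre val ltn)).
- by move=> ? ? ?; apply: ltn_trans.
- by move=> ?; apply: ltnn.
- exact: sorted_enum_ord.
- apply: (homo_sorted_in (P := mem I) _ _ (sorted_enum_ord I)); last first.
    by apply/allP => i; rewrite mem_enum.
  move=> i j /= iI jI lt_ij.
  have ne_q l : l \in I -> val l != q by apply: contraTneq => /val_inj ->.
  have := ne_q _ iI; have := ne_q _ jI; move: pq lt_ij; rewrite /adjacent.
  case: (eqVneq i p) => [->|]; case: (eqVneq j p) => [->|];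
    by rewrite -?(inj_eq val_inj) /=; lia.
move=> i; rewrite mem_enum /transfer pI qI /= !inE.
apply/idP/mapP => [/orP[/eqP->|/andP[ip iI]]|[j]].
- by exists p; rewrite ?mem_enum ?eqxx.
- by exists i; rewrite ?mem_enum ?(negPf ip).
rewrite mem_enum => jI ->; case: (eqVneq j p) => [_|jp]; first by rewrite eqxx.
by rewrite jp jI orbT.
Qed.

(** Row p of the product is row p of M plus t times row q of M.  By
    multilinearity the minor splits in two; the second one has row p replaced
    by row q, hence two equal rows when q was already there. *)
Lemma minor_shear (R : realType) n (p q : 'I_n) (t : R) (I J : {set 'I_n})
    (M : 'M[R]_n) :
  adjacent p q -> #|I| = #|J| ->
  minor I J ((1%:M + t *: delta_mx p q) *m M) =
  minor I J M +
  t * (if (p \in I) && (q \notin I) then minor (transfer p q I) J M else 0).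
Proof.
move=> pq cIJ; have NE i j :
    ((1%:M + t *: delta_mx p q) *m M) i j = M i j + (i == p)%:R * (t * M q j).
  rewrite mulmxDl mul1mx -scalemxAl !mxE (bigD1 q) //= big1 => [|l ql].
    by rewrite !mxE eqxx andbT addr0 mulrCA.
  by rewrite !mxE (negPf ql) andbF mul0r.
have cJ := esym cIJ; move: (_ *m M) NE => N NE.
rewrite !(minorE p _ erefl cJ).
have [pI|pI] := boolP (p \in I); last first.
  rewrite mulr0 addr0; congr (\det _); apply/matrixP => i j; rewrite !mxE NE.
  suff /negPf -> : nth p (enum I) i != p by rewrite mul0r addr0.
  by apply: contraNneq pI => <-; rewrite -mem_enum mem_nth // -cardE.
have lt_p : (index p (enum I) < #|I|)%N by rewrite cardE index_mem mem_enum.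
set i0 := Ordinal lt_p.
have nth_i0 : nth p (enum I) i0 = p by rewrite nth_index ?mem_enum.
have nth_p (i : 'I_#|I|) : (nth p (enum I) i == p) = (i == i0).
  by rewrite -{2}nth_i0 nth_uniq ?enum_uniq -?cardE.
pose f (i : 'I_n) := if i == p then q else i.
(* Row i0 is the row of the determinant that comes from row p of M. *)
rewrite (determinant_multilinear (i0 := i0) (b := 1) (c := t)
  (B := \matrix_(i < #|I|, j < #|I|) M (nth p (enum I) i) (nth p (enum J) j))
  (C := \matrix_(i < #|I|, j < #|I|)
           M (f (nth p (enum I) i)) (nth p (enum J) j)));
  first last.
- apply/matrixP => i j; rewrite !mxE NE /f nth_p.
  by rewrite eq_sym (negPf (neq_lift _ _)) mul0r addr0.
- apply/matrixP => i j; rewrite !mxE NE nth_p.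
  by rewrite eq_sym (negPf (neq_lift _ _)) mul0r addr0.
- by apply/rowP => j; rewrite !mxE NE /f nth_p eqxx !mul1r.
rewrite mul1r; congr (_ + t * _); have [qI|qI] /= := boolP (q \in I).
  have lt_q : (index q (enum I) < #|I|)%N by rewrite cardE index_mem mem_enum.
  have nth_q : nth p (enum I) (Ordinal lt_q) = q by rewrite nth_index ?mem_enum.
  have qp : q != p by apply: contraTneq pq => ->; rewrite /adjacent; lia.
  apply: (determinant_alternate (i1 := i0) (i2 := Ordinal lt_q)).
    by rewrite eq_sym -nth_p nth_q.
  by move=> j; rewrite !mxE nth_i0 nth_q /f eqxx (negPf qp).
rewrite (minorE p _ (card_transfer p q I) cJ).
congr (\det _); apply/matrixP => i j; rewrite !mxE; congr (M _ _).
by rewrite enum_transfer // (nth_map p) // -cardE.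
Qed.

Lemma minor_diag_mul (R : realType) n (d : 'rV[R]_n) (I J : {set 'I_n})
    (M : 'M[R]_n) :
  minor I J (diag_mx d *m M) =
  (\prod_(i < #|I|) d 0 (enum_val i)) * minor I J M.
Proof.
rewrite /minor; set X := (X in _ = _ * \det X).
have -> : \prod_(i < #|I|) d 0 (enum_val i)
          = \det (diag_mx (\row_(i < #|I|) d 0 (enum_val i))).
  by rewrite det_diag; apply: eq_bigr => i _; rewrite mxE.
rewrite -det_mulmx; congr (\det _); apply/matrixP => i j.
by rewrite !mul_diag_mx !mxE.
Qed.

Lemma minor1 (R : realType) n (I J : {set 'I_n}) :
  #|I| = #|J| -> minor I J (1%:M : 'M[R]_n) = (I == J)%:R.
Proof.
move=> cIJ; have [<-{J cIJ}|neIJ] := eqVneq I J.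
  rewrite /minor -[RHS](det1 R #|I|); congr (\det _); apply/matrixP => i j.
  by rewrite !mxE -enum_val_nth (inj_eq enum_val_inj).
have /subsetPn[x xI xJ] : ~~ (I \subset J).
  by apply: contra neIJ => sIJ; rewrite eqEcard sIJ cIJ leqnn.
(* The row of the identity at an element x of I outside J vanishes on J. *)
rewrite (minorE x _ erefl (esym cIJ)).
have lt_x : (index x (enum I) < #|I|)%N by rewrite cardE index_mem mem_enum.
rewrite (expand_det_row _ (Ordinal lt_x)) big1 // => j _.
rewrite !mxE nth_index ?mem_enum // -[x == _]negbK.
rewrite (_ : x != _) ?mul0r //; apply: contraNneq xJ => ->.
by rewrite -mem_enum mem_nth // -cardE -cIJ.
Qed.

Lemma minor_tr (R : realType) n (x0 : 'I_n) (I J : {set 'I_n}) (M : 'M[R]_n) :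
  #|I| = #|J| -> minor I J M^T = minor J I M.
Proof.
move=> cIJ; rewrite (minorE x0 _ cIJ erefl) (minorE x0 _ erefl cIJ) -det_tr.
by congr (\det _); apply/matrixP => i j; rewrite !mxE.
Qed.

(** * Positivity of minors as reachability *)

(** Nonnegativity is carried along because a sum of nonnegative minors is
    positive as soon as one of them is: this turns the sum in minor_shear into
    the disjunction in reach. *)
Definition realizes (R : realType) n (w : seq (bool * 'I_n.-1)) (M : 'M[R]_n) :=
  forall I J : {set 'I_n}, #|I| = #|J| ->
  0 <= minor I J M /\ (0 < minor I J M) = reach w I J.

Lemma realizes1 (R : realType) n : realizes [::] (1%:M : 'M[R]_n).
Proof. by move=> I J cIJ; rewrite minor1 // ler0n ltr0n lt0b. Qed.

Lemma realizes_shear (R : realType) n (w : seq (bool * 'I_n.-1)) mv (p q : 'I_n)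
    (t : R) (M : 'M[R]_n) :
  adjacent p q -> move mv =1 transfer p q -> 0 < t -> realizes w M ->
  realizes (mv :: w) ((1%:M + t *: delta_mx p q) *m M).
Proof.
move=> pq mvE t_gt0 wM I J cIJ; rewrite minor_shear //= mvE.
have [M_ge0 M_gt0] := wM I J cIJ.
have [pI|pI] := ifP; last first.
  by rewrite mulr0 addr0 /transfer pI orbb.
have [M'_ge0 M'_gt0] := wM (transfer p q I) J (etrans (card_transfer p q I) cIJ).
have tM'_ge0 := mulr_ge0 (ltW t_gt0) M'_ge0.
split; first exact: addr_ge0.
rewrite -M_gt0 -M'_gt0 lt0r addr_ge0 // andbT paddr_eq0 // negb_and.
by rewrite [0 < minor I J M]lt0r M_ge0 [in RHS]lt0r M'_ge0 mulf_eq0 (gt_eqF t_gt0)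
  !andbT.
Qed.

Lemma realizes_diag (R : realType) n (w : seq (bool * 'I_n.-1)) (d : 'rV[R]_n)
    (M : 'M[R]_n) :
  (forall i, 0 < d 0 i) -> realizes w M -> realizes w (diag_mx d *m M).
Proof.
move=> d_gt0 wM I J cIJ; have [M_ge0 M_gt0] := wM I J cIJ.
have prod_gt0 : 0 < \prod_(i < #|I|) d 0 (enum_val i) by apply: prodr_gt0.
by rewrite minor_diag_mul pmulr_rge0 // pmulr_rgt0.
Qed.

Definition moves n (b : bool) (Q : seq 'I_n.-1) : seq (bool * 'I_n.-1) :=
  [seq (b, a) | a <- Q].

Lemma realizes_x_prod (R : realType) n (w : seq (bool * 'I_n.-1))
    (s : seq ('I_n.-1 * R)) (M : 'M[R]_n) :
  {in s, forall f, 0 <= f.2} -> realizes w M ->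
  realizes (moves true (positions s) ++ w) (x_prod s *m M).
Proof.
rewrite /x_prod /positions; elim: s => [|f s IHs] f_ge0 wM.
  by rewrite big_nil mul1mx.
have {}IHs := IHs (fun g gs => f_ge0 g (mem_behead (s := f :: s) gs)) wM.
rewrite big_cons -[_ * _]/(_ *m _) -mulmxA /=.
have [f0|f0] := eqVneq f.2 0.
  by rewrite /x_factor f0 scale0r addr0 mul1mx.
apply: realizes_shear => //; first by rewrite /adjacent eqxx.
by rewrite lt0r f0 f_ge0 ?mem_head.
Qed.

Lemma realizes_y_prod (R : realType) n (w : seq (bool * 'I_n.-1))
    (s : seq ('I_n.-1 * R)) (M : 'M[R]_n) :
  {in s, forall f, 0 <= f.2} -> realizes w M ->
  realizes (moves false (positions s) ++ w) (y_prod s *m M).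
Proof.
rewrite /y_prod /positions; elim: s => [|f s IHs] f_ge0 wM.
  by rewrite big_nil mul1mx.
have {}IHs := IHs (fun g gs => f_ge0 g (mem_behead (s := f :: s) gs)) wM.
rewrite big_cons -[_ * _]/(_ *m _) -mulmxA /=.
have [f0|f0] := eqVneq f.2 0.
  by rewrite /y_factor f0 scale0r addr0 mul1mx.
apply: realizes_shear => //; first by rewrite /adjacent eqxx orbT.
by rewrite lt0r f0 f_ge0 ?mem_head.
Qed.

Definition factor_word (R : realType) n (sL sU : seq ('I_n.-1 * R)) m :=
  flatten (nseq m (moves false (positions sL) ++ moves true (positions sU))).

Lemma realizes_exp (R : realType) n (B : 'M[R]_n) sL d sU m :
  adjacent_bidiagonal_factorization B sL d sU ->
  realizes (factor_word sL sU m) (B ^+ m).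
Proof.
case=> sL_ge0 d_gt0 sU_ge0 defB; elim: m => [|m IHm].
  by rewrite expr0; apply: realizes1.
rewrite exprS [X in X * _]defB -[_ * _]/(_ *m _) -!mulmxA /factor_word /= -catA.
by apply: realizes_y_prod => //; apply: realizes_diag => //; apply: realizes_x_prod.
Qed.

Lemma ups_factor_word (R : realType) n (sL sU : seq ('I_n.-1 * R)) m :
  ups (factor_word sL sU m) = seq_power m (Qplus sU).
Proof.
rewrite /factor_word /seq_power /ups; elim: m => //= m IHm.
rewrite !filter_cat !map_cat IHm /Qplus; congr (_ ++ _).
rewrite [X in X ++ _](_ : _ = [::]); last by elim: (positions sL).
by elim: (positions sU) => //= a Q ->.
Qed.

(** * Corner minors of powers *)

Lemma corner_minor_exp (R : realType) n (B : 'M[R]_n) sL d sU m k :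
  adjacent_bidiagonal_factorization B sL d sU -> (k <= n)%N ->
  0 < minor (init_set n k) (final_set n k) (B ^+ m) <->
  cplus_seq (seq_power m (Qplus sU)) (init_set n k) = final_set n k.
Proof.
move=> factB le_kn; rewrite -(ups_factor_word sL) -reach_init_final //.
by rewrite (realizes_exp m factB _).2 ?card_init ?card_final.
Qed.

Lemma factorization_tr (R : realType) n (B : 'M[R]_n) sL d sU :
  adjacent_bidiagonal_factorization B sL d sU ->
  adjacent_bidiagonal_factorization B^T (rev sU) d (rev sL).
Proof.
case=> sL_ge0 d_gt0 sU_ge0 ->; split=> //.
- by move=> f; rewrite mem_rev; apply: sU_ge0.
- by move=> f; rewrite mem_rev; apply: sL_ge0.
have -> : y_prod (rev sU) = (x_prod sU)^T.
  by rewrite -[LHS]trmxK trmx_y_prod revK.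
by rewrite !trmx_mul tr_diag_mx trmx_y_prod mulmxA.
Qed.

Lemma trmx_exp (R : realType) n (B : 'M[R]_n) m : (B ^+ m)^T = B^T ^+ m.
Proof.
elim: m => [|m IHm]; first by rewrite !expr0 trmx1.
by rewrite exprS exprSr -IHm; apply: trmx_mul.
Qed.

(** * Hitting times *)

Lemma cplus_final n (a : 'I_n.-1) k : cplus a (final_set n k) = final_set n k.
Proof. by rewrite /cplus !inE; case: ifP => //= /andP[]; lia. Qed.

Lemma cplus_seq_final n (Q : seq 'I_n.-1) k :
  cplus_seq Q (final_set n k) = final_set n k.
Proof. by elim: Q => //= a Q; rewrite cplus_final. Qed.

Lemma cplus_seq_power_leq n (Q : seq 'I_n.-1) (I : {set 'I_n}) k m m' :
  (m <= m')%N -> cplus_seq (seq_power m Q) I = final_set n k ->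
  cplus_seq (seq_power m' Q) I = final_set n k.
Proof.
move=> /subnKC <- eq_m; rewrite /seq_power nseqD flatten_cat /cplus_seq foldl_cat.
by rewrite -/(seq_power m Q) -/(cplus_seq _ I) eq_m; apply: cplus_seq_final.
Qed.

(** If position a is missing, the level at a+1 never changes, whereas it has to
    grow from 0 when the initial set of size a+1 is carried to the final one. *)
Lemma complete_of_corner n (Q : seq 'I_n.-1) :
  (forall k, (0 < k < n)%N ->
     exists m, cplus_seq (seq_power m Q) (init_set n k) = final_set n k) ->
  complete Q.
Proof.
move=> crossed a; have lt_an := pos_hi_subproof a.
have [|m /(congr1 (fun I => level I a.+1))] := crossed a.+1; first by lia.
rewrite level_final ?(ltnW lt_an) //; apply: contra_eqT => aQ.
suff -> : level (cplus_seq (seq_power m Q) (init_set n a.+1)) a.+1 = 0%N by lia.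
have {aQ} : a \notin seq_power m Q.
  by apply: contra aQ => /flattenP[Q' /nseqP[-> _]].
have : level (init_set n a.+1) a.+1 = 0%N.
  by rewrite level_init ?(ltnW lt_an) ?subnn.
elim: (seq_power m Q) (init_set n a.+1) => //= b Q' IHQ I lev0.
rewrite inE negb_or => /andP[ab aQ']; apply: IHQ => //.
by rewrite level_cplus lev0 eqSS (inj_eq val_inj) (negPf ab).
Qed.

Lemma least_timeP (P : nat -> Prop) :
  if least_time P is Some m
  then [/\ (0 < m)%N, P m & forall m', (0 < m')%N -> P m' -> (m <= m')%N]
  else forall m, (0 < m)%N -> ~ P m.
Proof.
rewrite /least_time; case: pselect => [exP|noP].
  case: ex_minnP => m /andP[m_gt0 /asboolP Pm] min_m; split=> // m' m'_gt0 Pm'.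
  by apply: min_m; rewrite m'_gt0; apply/asboolP.
by move=> m m_gt0 Pm; apply: noP; exists m; rewrite m_gt0; apply/asboolP.
Qed.

Lemma eq_least_time (P Q : nat -> Prop) :
  (forall m, (0 < m)%N -> P m <-> Q m) -> least_time P = least_time Q.
Proof.
move=> eqPQ; have := (least_timeP P, least_timeP Q).
case: (least_time P) (least_time Q) => [p|] [q|] //= [].
- move=> [p_gt0 /(eqPQ _ p_gt0) Qp min_p] [q_gt0 /(eqPQ _ q_gt0) Pq min_q].
  by congr Some; apply/eqP; rewrite eqn_leq min_p ?min_q.
- by move=> [p_gt0 /(eqPQ _ p_gt0) Qp _] /(_ p p_gt0).
- by move=> noP [q_gt0 /(eqPQ _ q_gt0) /(noP _ q_gt0)].
Qed.

(** Conditions that persist in time hold jointly from the later of their two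
    first times on. *)
Lemma least_time_and (P Q : nat -> Prop) :
  (forall m m', (m <= m')%N -> P m -> P m') ->
  (forall m m', (m <= m')%N -> Q m -> Q m') ->
  least_time (fun m => P m /\ Q m) = time_max (least_time P) (least_time Q).
Proof.
move=> upP upQ; have := least_timeP (fun m => P m /\ Q m).
have := (least_timeP P, least_timeP Q).
case: (least_time P) (least_time Q) => [p|] [q|] [] /=; first last.
- by move=> noP _; case: least_time => // r [r_gt0 [/(noP _ r_gt0)]].
- by move=> noP _; case: least_time => // r [r_gt0 [/(noP _ r_gt0)]].
- by move=> _ noQ; case: least_time => // r [r_gt0 [_ /(noQ _ r_gt0)]].
move=> [p_gt0 Pp min_p] [q_gt0 Qq min_q].
have pq_gt0 : (0 < maxn p q)%N by rewrite leq_max p_gt0.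
have PQ : P (maxn p q) /\ Q (maxn p q).
  by split; [apply: upP Pp | apply: upQ Qq]; rewrite leq_max leqnn ?orbT.
case: least_time => [r [r_gt0 [Pr Qr] min_r]|/(_ _ pq_gt0)//].
by congr Some; apply/eqP; rewrite eqn_leq min_r //= geq_max min_p ?min_q.
Qed.

(** * Minors of a fixed order and the theorem *)

(** Among the minors of order k, the two corner ones are the hardest to make
    positive. *)
Lemma all_minors_exp (R : realType) n (B : 'M[R]_n) sL d sU m k :
  adjacent_bidiagonal_factorization B sL d sU -> (k <= n)%N ->
  (forall I J : {set 'I_n}, #|I| = k -> #|J| = k -> 0 < minor I J (B ^+ m)) <->
  0 < minor (init_set n k) (final_set n k) (B ^+ m) /\
  0 < minor (final_set n k) (init_set n k) (B ^+ m).
Proof.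
move=> factB le_kn; split=> [pos|[]]; first by rewrite !pos ?card_init ?card_final.
have minE (I J : {set 'I_n}) : #|I| = k -> #|J| = k ->
    (0 < minor I J (B ^+ m)) = reach (factor_word sL sU m) I J.
  by move=> cI cJ; rewrite (realizes_exp m factB _).2 // cI.
rewrite !minE ?card_init ?card_final // => rUR rLL I J cI cJ.
by rewrite minE //; apply: reach_all rLL.
Qed.

Theorem lemma5p1 (R : realType) (n : nat) (n_ge2 : (2 <= n)%N)
    (B : 'M[R]_n) (B_unit : B \in unitmx) (B_TN : totally_nonnegative B)
    (sL : seq ('I_n.-1 * R)) (d : 'rV[R]_n) (sU : seq ('I_n.-1 * R))
    (B_fact : adjacent_bidiagonal_factorization B sL d sU) :
  (forall m k : nat, (1 <= m)%N -> (1 <= k < n)%N ->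
     (0 < minor (init_set n k) (final_set n k) (B ^+ m) <->
      cplus_seq (seq_power m (Qplus sU)) (init_set n k) = final_set n k)
     /\
     (0 < minor (final_set n k) (init_set n k) (B ^+ m) <->
      cplus_seq (seq_power m (Qminus sL)) (init_set n k) = final_set n k))
  /\
  (oscillatory B ->
     [/\ complete (Qplus sU), complete (Qminus sL) &
         forall k : nat, (1 <= k < n)%N ->
           [/\ tau_UR k B = t_time k (Qplus sU),
               tau_LL k B = t_time k (Qminus sL) &
               exponent k B =
                 time_max (t_time k (Qplus sU)) (t_time k (Qminus sL))]]).
Proof.
have corners (m k : nat) : (k <= n)%N ->
    (0 < minor (init_set n k) (final_set n k) (B ^+ m) <->
     cplus_seq (seq_power m (Qplus sU)) (init_set n k) = final_set n k) /\
    (0 < minor (final_set n k) (init_set n k) (B ^+ m) <->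
     cplus_seq (seq_power m (Qminus sL)) (init_set n k) = final_set n k).
  move=> le_kn; split; first exact: corner_minor_exp B_fact le_kn.
  rewrite -(corner_minor_exp m (factorization_tr B_fact) le_kn) -trmx_exp.
  by rewrite (minor_tr (Ordinal (ltnW n_ge2))) // card_init ?card_final.
split=> [m k _ /andP[_ /ltnW]|[_ [m0 m0_gt0 TPm0]]]; first exact: corners.
split.
- apply: complete_of_corner => k /andP[_ /ltnW le_kn]; exists m0.
  by apply/(corners m0 k le_kn).1; apply: TPm0; rewrite card_init ?card_final.
- apply: complete_of_corner => k /andP[_ /ltnW le_kn]; exists m0.
  by apply/(corners m0 k le_kn).2; apply: TPm0; rewrite card_init ?card_final.
move=> k /andP[_ /ltnW le_kn].
split; try by apply: eq_least_time => m _; have [] := corners m k le_kn.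
rewrite /t_time -least_time_and; try by move=> m m'; apply: cplus_seq_power_leq.
apply: eq_least_time => m _; rewrite (all_minors_exp m B_fact le_kn).
by have [-> ->] := corners m k le_kn.
Qed.
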